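(* Let $P\in\{\textsf{LEV-ORD},\textsf{ASS-ORD},\textsf{ASS-R-ORD},\textsf{ANY-ORD}\}$ and $R\in\{\textsf{RED},\textsf{NO-RED}\}$. The proof system $\mathsf{QCDCL}^{P}_{R}$ is complete: every false QCNF has a $\mathsf{QCDCL}^{P}_{R}$ refutation.
   Context: QBF basics. A literal is a variable $x$ or $\bar x$; a clause is a disjunction of literals identified with its set of literals; $(\bot)$ is the empty clause. A QCNF is $\Phi=\mathcal{Q}\cdot\phi$ with prefix $\mathcal{Q}=Q_1X_1\dots Q_sX_s$ (disjoint nonempty variable sets, alternating $Q_i\in\{\exists,\forall\}$) and matrix $\phi$ a CNF of non-tautological clauses; it is false if the quantified Boolean formula evaluates to false. $\mathrm{lv}(x)=i$ if the variable of $x$ is in $X_i$; existential/universal variables are those in $\exists$/$\forall$-blocks. $\mathrm{red}(C)$ deletes from $C$ every universal literal $v$ with $\mathrm{lv}(v)>\mathrm{lv}(x)$ for all existential $x\in C$. For existential $\ell$ not occurring (as variable) in $C_1,C_2$: $(C_1\vee\ell)\otimes_\ell(C_2\vee\bar\ell)=C_1\vee C_2$. QCDCL. $C|_\sigma=\top$ if $C\cap\sigma\neq\emptyset$, else the clause of all $\ell\in C$ with $\bar\ell\notin\sigma$. A trail for $\Phi=\mathcal{Q}\cdot\phi$ is $\mathcal{T}=(p_{(0,1)},\dots,p_{(0,g_0)};d_1,p_{(1,1)},\dots,p_{(1,g_1)};\dots;d_r,p_{(r,1)},\dots,p_{(r,g_r)})$, a sequence of literals with no variable occurring twice; $d_i$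 decision literals, $p_{(i,j)}$ propagated literals (existential, or $\bot$ only as last element: a conflict). $\mathcal{T}[s,t]$: initial segment ending at $p_{(s,t)}$ (at $d_s$ if $t=0$; $\mathcal{T}[0,0]$ empty). Each $p_{(i,j)}$ has an antecedent $\mathrm{ante}(p_{(i,j)})\in\phi$ with: under RED, $\mathrm{red}(\mathrm{ante}(p_{(i,j)})|_{\mathcal{T}[i,j-1]})=(p_{(i,j)})$; under NO-RED, $\mathrm{ante}(p_{(i,j)})|_{\mathcal{T}[i,j-1]}=(p_{(i,j)})$ ($(\bot)$ = empty clause). Decision policies: LEV-ORD: $\mathrm{lv}(d_i)\le\mathrm{lv}(x)$ for all variables $x$ of $\phi$ unassigned in $\mathcal{T}[i-1,g_{i-1}]$; ASS-ORD: existential literals may always be decided, a universal $d_k$ only if $\mathrm{lv}(d_1)\le\dots\le\mathrm{lv}(d_k)$; ASS-R-ORD: an existential $x$ may be decided only if every universal $u$ with $\mathrm{lv}(u)<\mathrm{lv}(x)$ has already been decided; ANY-ORD: no restriction. A clause $C$ is unit under RED if $\mathrm{red}(C)=(x)$, $x$ existential, or $\mathrm{red}(C)$ empty ($x=\bot$); under NO-RED if $C=(x)$, $x$ existential, or $C$ empty. Natural condition at an initial segment without $\bot$: if some clauses of the current clause set are unit under it, the next element is the literal of one of them with that clause as antecedent, and is $\bot$ if possible; natural trail: holds everywhere. Learnable clauses of a trail ending in $\bot$: $C_{(r,g_r)}=\mathrm{red}(\mathrm{ante}(\bot))$; leftwards over propagated $p$, with $C'$ the clause of the next propagated literal to the right,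 the clause of $p$ is $\mathrm{red}(C'\otimes_p\mathrm{red}(\mathrm{ante}(p)))$ if $\bar p\in C'$, else $C'$; $\mathcal{L}_\mathcal{T}$ is this sequence, each with the derivation given by these steps. A $\mathsf{QCDCL}^{P}_{R}$ proof of $C$ from $\Phi$ is $((\mathcal{T}_1,\dots,\mathcal{T}_m),(C_1,\dots,C_m),(\pi_1,\dots,\pi_m))$: each $\mathcal{T}_i$ a trail following $P,R$ for $\mathcal{Q}\cdot(\phi\cup\{C_1,\dots,C_{i-1}\})$ that has run into a conflict, $C_i\in\mathcal{L}_{\mathcal{T}_i}$ with derivation $\pi_i$, $C_m=C$, $\mathcal{T}_1$ natural, and for $i\ge2$ some $(s,t)$ with $\mathcal{T}_i[s,t]=\mathcal{T}_{i-1}[s,t]$ such that $\mathcal{T}_i$ satisfies the natural condition at all initial segments extending $\mathcal{T}_i[s,t]$. It is a refutation if $C=(\bot)$. *)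

(* Defs.v *)
From HB Require Import structures.
From mathcomp Require Import all_boot.

Set Implicit Arguments.
Unset Strict Implicit.
Unset Printing Implicit Defensive.

Variant quantifier := Exists | Forall.

Definition is_exists (q : quantifier) : bool :=
  if q is Exists then true else false.

Variant decision_policy := LevOrd | AssOrd | AssROrd | AnyOrd.

Variant reduction_policy := Red | NoRed.

Section Syntax.

Variable V : finType.

(* (x, true) is the literal x and (x, false) is the literal \bar x. *)
Definition literal := (V * bool)%type.
Definition neg (l : literal) : literal := (l.1, ~~ l.2).

Definition clause := {set literal}.
Definition cnf := {set clause}.

Definition tautological (C : clause) : bool :=
  [exists l in C, neg l \in C].

Definition cvars (phi : cnf) : {set V} :=
  [set x | [exists C in phi, [exists l in C, l.1 == x]]].

Definition block := (quantifier * {set V})%type.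
Definition prefix_vars (Q : seq block) : {set V} :=
  [set x | has (fun B : block => x \in B.2) Q].

Record qcnf := QCNF {
  qprefix : seq block;
  matrix : cnf;
  blocks_nonempty : all (fun B : block => B.2 != set0) qprefix;
  blocks_disjoint : pairwise (fun B B' : block => [disjoint B.2 & B'.2]) qprefix;
  blocks_alternate :
    sorted (fun B B' : block => is_exists B.1 != is_exists B'.1) qprefix;
  qcnf_closed : cvars matrix \subset prefix_vars qprefix;
  clauses_nontaut : forall C, C \in matrix -> ~~ tautological C
}.

Definition assignment := {ffun V -> bool}.

Definition sat (phi : cnf) (a : assignment) : bool :=
  [forall C in phi, [exists l in C, a l.1 == l.2]].

Definition agree_off (X : {set V}) (a b : assignment) : bool :=
  [forall x, (x \notin X) ==> (b x == a x)].

Fixpoint qeval (Q : seq block) (phi : cnf) (a : assignment) : bool :=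
  match Q with
  | [::] => sat phi a
  | (Exists, X) :: Q' => [exists b, agree_off X a b && qeval Q' phi b]
  | (Forall, X) :: Q' => [forall b, agree_off X a b ==> qeval Q' phi b]
  end.

(* A qcnf is closed, so its value does not depend on the assignment with which
   the evaluation starts. *)
Definition qcnf_value (Phi : qcnf) : bool :=
  qeval (qprefix Phi) (matrix Phi) [ffun=> false].

Definition qcnf_false (Phi : qcnf) : Prop := qcnf_value Phi = false.

Section Prefix.

Variable Q : seq block.

(* Blocks are numbered from 1; meaningful for x in prefix_vars Q only. *)
Definition lv (x : V) : nat := (find (fun B : block => x \in B.2) Q).+1.

Definition existential (x : V) : bool :=
  has (fun B : block => is_exists B.1 && (x \in B.2)) Q.
Definition universal (x : V) : bool :=
  has (fun B : block => ~~ is_exists B.1 && (x \in B.2)) Q.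

Definition red (C : clause) : clause :=
  [set v in C | ~~ (universal v.1 &&
     [forall x in C, existential x.1 ==> (lv x.1 < lv v.1)])].

Definition reduct (R : reduction_policy) (C : clause) : clause :=
  if R is Red then red C else C.

End Prefix.

(* resolve l C D is C \otimes_l D for l in C and neg l in D. *)
Definition resolve (l : literal) (C D : clause) : clause :=
  (C :\ l) :|: (D :\ neg l).

Lemma resolveE (l : literal) (C1 C2 : clause) :
  (forall k, k \in C1 :|: C2 -> k.1 != l.1) ->
  resolve l (l |: C1) (neg l |: C2) = C1 :|: C2.
Proof.
move=> H; apply/setP=> k; rewrite !inE.
have := H k; rewrite !inE => Hk.
case: (k =P l) Hk => [-> | _] /= Hk.
  have: ~~ ((l \in C1) || (l \in C2)) by apply/negP=> /Hk; rewrite eqxx.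
  by rewrite negb_or => /andP[/negbTE-> /negbTE->]; case: (l == neg l).
case: (k =P neg l) Hk => [-> | _] //= Hk.
have: ~~ ((neg l \in C1) || (neg l \in C2)) by apply/negP=> /Hk; rewrite eqxx.
by rewrite negb_or => /andP[/negbTE-> /negbTE->].
Qed.

(* None stands for \top. *)
Definition restrict (C : clause) (sigma : seq literal) : option clause :=
  if [exists l in C, l \in sigma] then None
  else Some [set l in C | neg l \notin sigma].

(* A propagated element carries its antecedent; the propagated literal None
   is \bot. *)
Variant trail_elem :=
  | Decide of literal
  | Propagate of option literal & clause.

(* The trail (p_(0,1), ..; d_1, p_(1,1), ..; ..) is flattened to one sequence,
   in which the decisions mark the start of the blocks. Its initial segments
   T[s,t] are the sequences take k T with k <= size T. *)
Definition trail := seq trail_elem.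

Definition elem_lit (e : trail_elem) : option literal :=
  match e with Decide d => Some d | Propagate p _ => p end.

Definition elem_dec (e : trail_elem) : option literal :=
  if e is Decide d then Some d else None.

Definition is_conflict (e : trail_elem) : bool :=
  if e is Propagate None _ then true else false.

Definition trail_lits (T : trail) : seq literal := pmap elem_lit T.
Definition trail_vars (T : trail) : seq V := [seq l.1 | l <- trail_lits T].
Definition decisions (T : trail) : seq literal := pmap elem_dec T.

Section Trails.

Variables (P : decision_policy) (R : reduction_policy).
Variables (Q : seq block) (phi : cnf).

Definition unit_literal (D : clause) (p : option literal) : Prop :=
  match p with
  | Some l => existential Q l.1 /\ reduct Q R D = [set l]
  | None => reduct Q R D = set0
  end.

Definition unit_under (S : trail) (C : clause) (p : option literal) : Prop :=
  exists2 D, restrict C (trail_lits S) = Some D & unit_literal D p.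

Definition decision_allowed (S : trail) (d : literal) : Prop :=
  match P with
  | LevOrd => forall x, x \in cvars phi -> x \notin trail_vars S ->
                lv Q d.1 <= lv Q x
  | AssOrd => universal Q d.1 ->
                sorted leq [seq lv Q l.1 | l <- rcons (decisions S) d]
  | AssROrd => existential Q d.1 -> forall u, universal Q u ->
                lv Q u < lv Q d.1 -> u \in [seq l.1 | l <- decisions S]
  | AnyOrd => True
  end.

Definition is_trail (T : trail) : Prop :=
  uniq (trail_vars T) /\
  forall k e, onth T k = Some e ->
    match e with
    | Decide d => d.1 \in prefix_vars Q /\ decision_allowed (take k T) d
    | Propagate p A =>
        [/\ A \in phi, unit_under (take k T) A p
          & p = None -> size T = k.+1]
    end.

Definition in_conflict (T : trail) : Prop :=
  exists A T', T = rcons T' (Propagate None A).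

Definition natural_at (T : trail) (k : nat) : Prop :=
  let S := take k T in
  ~~ has is_conflict S ->
  (exists C p, C \in phi /\ unit_under S C p) ->
  exists C p,
    [/\ C \in phi, unit_under S C p, onth T k = Some (Propagate p C)
      & (exists2 C', C' \in phi & unit_under S C' None) -> p = None].

Definition natural_from (T : trail) (k : nat) : Prop :=
  forall j, k <= j <= size T -> natural_at T j.

End Trails.

Inductive derivation :=
  | Ax_step of clause
  | Red_step of derivation
  | Res_step of literal & derivation & derivation.

Section Learning.

Variable Q : seq block.

Fixpoint conclusion (pi : derivation) : clause :=
  match pi with
  | Ax_step C => C
  | Red_step pi1 => red Q (conclusion pi1)
  | Res_step l pi1 pi2 => resolve l (conclusion pi1) (conclusion pi2)
  end.

(* rT is the part of the trail still to be processed, read from right to left,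
   and pi derives the clause of the next propagated literal to its right. In a
   trail, neg p lies in conclusion pi without p, and p lies in red A without
   neg p, so that the resolution step below is well-formed. *)
Fixpoint learn (pi : derivation) (rT : trail) : seq derivation :=
  match rT with
  | [::] => [::]
  | Propagate (Some p) A :: rT' =>
      let pi' := if neg p \in conclusion pi
                 then Red_step (Res_step (neg p) pi (Red_step (Ax_step A)))
                 else pi in
      pi' :: learn pi' rT'
  | _ :: rT' => learn pi rT'
  end.

Definition learnable (T : trail) : seq (clause * derivation) :=
  if rev T is Propagate None A :: rT then
    let pi := Red_step (Ax_step A) in
    [seq (conclusion pi', pi') | pi' <- pi :: learn pi rT]
  else [::].

End Learning.

Record qcdcl_object := QCDCL {
  trails : seq trail;
  learned : seq clause;
  derivations : seq derivation
}.

(* The natural condition is imposed on the first trail from its start, and on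
   every later trail from the point k to which the previous one backtracked. *)
Definition qcdcl_proof (P : decision_policy) (R : reduction_policy)
    (Phi : qcnf) (C : clause) (pf : qcdcl_object) : Prop :=
  [/\ size (trails pf) = size (learned pf),
      size (derivations pf) = size (learned pf),
      onth (learned pf) (size (learned pf)).-1 = Some C
    & forall i T Ci pi,
        onth (trails pf) i = Some T ->
        onth (learned pf) i = Some Ci ->
        onth (derivations pf) i = Some pi ->
        let Q := qprefix Phi in
        let phi := matrix Phi :|: [set D in take i (learned pf)] in
        [/\ is_trail P R Q phi T,
            in_conflict T,
            exists j, onth (learnable Q T) j = Some (Ci, pi)
          & if i is i'.+1 then
              exists T' k,
                [/\ onth (trails pf) i' = Some T',
                    k <= size T, k <= size T',
                    take k T = take k T'
                  & natural_from R Q phi T k]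
            else natural_from R Q phi T 0]].

Definition qcdcl_refutation (P : decision_policy) (R : reduction_policy)
    (Phi : qcnf) (pf : qcdcl_object) : Prop :=
  qcdcl_proof P R Phi set0 pf.

End Syntax.

(* Main.v *)
Require Import Defs.
From mathcomp Require Import all_boot.

Set Implicit Arguments.
Unset Strict Implicit.
Unset Printing Implicit Defensive.

(* Restart after every conflict, and let every decision take an unassigned
   variable of least level, universal variables being set by a winning strategy
   of the universal player. Such a trail obeys all four policies, and it reaches
   a conflict: were all variables assigned without one, the strategy would
   falsify a clause of the matrix. Since there are finitely many clauses, it
   suffices that each conflict yields the empty clause or a new clause.

   RED: scan the trail leftwards up to the first existential decision d whose
   negation is in the current clause C. Just before d, C was unsatisfied, all its
   existential literals but (neg d) were falsified, and its unassigned universal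
   literals had levels above d, so C was unit. If C were already known, the
   natural condition would have forbidden the decision d. If no such d exists,
   the leftmost clause has no existential literal and is empty.

   NO-RED: C need not be unit before d, as an existential literal propagated
   ahead of its level can protect a universal literal of C from reduction.
   Instead take the leftmost clause: its existential literals are all negated
   decisions, so its universal literals lie below the level of the last of them,
   d, and had been falsified before d; again C was unit before d. *)

(** * Literals, trails and their decisions *)

Section Literals.

Variable V : finType.
Implicit Types (l : literal V) (S T : trail V).

Lemma negK : involutive (@neg V).
Proof. by case=> x b; rewrite /neg /= negbK. Qed.

Lemma neg_neq l : neg l != l.
Proof. by case: l => x b; rewrite /neg xpair_eqE eqxx; case: b. Qed.

Lemma trail_lits_cat S T : trail_lits (S ++ T) = trail_lits S ++ trail_lits T.
Proof. exact: pmap_cat. Qed.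

Lemma decisions_cat S T : decisions (S ++ T) = decisions S ++ decisions T.
Proof. exact: pmap_cat. Qed.

Lemma trail_vars_cat S T : trail_vars (S ++ T) = trail_vars S ++ trail_vars T.
Proof. by rewrite /trail_vars trail_lits_cat map_cat. Qed.

Lemma decisions_sub T : {subset decisions T <= trail_lits T}.
Proof.
elim: T => [|e T IH] l //; case: e => [d|[p|] A] /=; rewrite ?inE //.
- by case/orP=> [->//|/IH ->]; rewrite orbT.
- by move/IH=> ->; rewrite orbT.
- exact: IH.
Qed.

Lemma mem_trail_vars S l :
  (l.1 \in trail_vars S) = (l \in trail_lits S) || (neg l \in trail_lits S).
Proof.
apply/idP/orP=> [/mapP[[x b] kS /= lk]|].
  case: l lk => y c /= ->; case: b kS => kS; case: c; rewrite /neg /= kS;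
    by [left | right].
by case=> lS; apply/mapP; [exists l | exists (neg l)].
Qed.

Lemma trail_consistent S l :
  uniq (trail_vars S) -> l \in trail_lits S -> neg l \notin trail_lits S.
Proof.
rewrite /trail_vars; elim: (trail_lits S) => [|k s IH] //= /andP[ks us].
have notin_s k' : k'.1 = k.1 -> k' \notin s.
  by move=> eqk; apply: contra ks => ?; apply/mapP; exists k'.
rewrite !inE; case: eqP => [->|_] /=.
  by rewrite (negbTE (neg_neq k)) notin_s.
case: eqP => [lk|_] /= lS; last exact: IH.
by rewrite (negbTE (notin_s l _)) -?lk in lS.
Qed.

Lemma decision_split T d : d \in decisions T ->
  exists S S', T = S ++ Decide d :: S'.
Proof.
elim: T => [|e T IH] //.
have shift : d \in decisions T -> exists S S', e :: T = S ++ Decide d :: S'.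
  by case/IH=> S [S' ->]; exists (e :: S), S'.
case: e shift => [d'|p A] shift //=; rewrite inE => /orP[/eqP<-|/shift//].
by exists [::], T.
Qed.

(** Serves to pick the rightmost decision whose negation occurs in the leftmost learned clause. *)
Lemma last_decision_split (p : pred (literal V)) T : has p (decisions T) ->
  exists S d S', [/\ T = S ++ Decide d :: S', p d & ~~ has p (decisions S')].
Proof.
elim: T => [|e T IH] //.
have shift : has p (decisions T) -> exists S d S',
    [/\ e :: T = S ++ Decide d :: S', p d & ~~ has p (decisions S')].
  by case/IH=> S [d [S' [-> pd nS']]]; exists (e :: S), d, S'.
case: e shift => [d|q A] shift //=.
case hT: (has p (decisions T)); first by rewrite hT in shift; move=> _; apply: shift.
by rewrite orbF => pd; exists [::], d, T; rewrite hT.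
Qed.

Lemma onth_take_drop (A : Type) (s : seq A) k a : onth s k = Some a ->
  s = take k s ++ a :: drop k.+1 s.
Proof.
elim: s k => [|b s IH] [|k] //=; first by case=> ->; rewrite drop0.
by move/IH=> {1}->.
Qed.

End Literals.

(** * Levels and quantifiers in a prefix *)

Lemma disjoint_blocks (V : finType) (p : pred (block V)) (X : {set V}) Q x :
  all (fun B : block V => [disjoint X & B.2]) Q -> x \in X ->
  has (fun B : block V => p B && (x \in B.2)) Q = false.
Proof.
elim: Q => [|B Q IH] //= /andP[dB dQ] xX.
by rewrite (disjointFr dB xX) andbF IH.
Qed.

Section Prefix.

Variables (V : finType) (Q : seq (block V)).
Hypothesis Qdisj : pairwise (fun B B' : block V => [disjoint B.2 & B'.2]) Q.

(** Equal levels mean a common block, and by disjointness no other block can supply the second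
    quantifier. *)
Lemma lv_existential_universal x u :
  existential Q x -> universal Q u -> lv Q x != lv Q u.
Proof.
elim: Q Qdisj => [|B Q' IH] //= /andP[dB dQ'].
rewrite /lv /=; case xB: (x \in B.2); case uB: (u \in B.2) => //=.
- rewrite -/(existential Q' x) -/(universal Q' u) !andbT.
  have -> : existential Q' x = false by apply: disjoint_blocks dB xB.
  have -> : universal Q' u = false by apply: disjoint_blocks dB uB.
  by rewrite !orbF; case: is_exists.
- by rewrite !andbF /= => ex un; rewrite eqSS; apply: IH.
Qed.

Lemma existentialN_universal x : existential Q x -> ~~ universal Q x.
Proof. by move=> ex; apply/negP=> /(lv_existential_universal ex); rewrite eqxx. Qed.

Lemma existentialVuniversal x :
  x \in prefix_vars Q -> existential Q x || universal Q x.
Proof.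
rewrite inE -has_predU; apply: sub_has => B /= ->.
by rewrite !andbT; case: is_exists.
Qed.

Lemma universal_prefix u : universal Q u -> u \in prefix_vars Q.
Proof. by rewrite inE; apply: sub_has => B /andP[]. Qed.

Lemma existential_prefix u : existential Q u -> u \in prefix_vars Q.
Proof. by rewrite inE; apply: sub_has => B /andP[]. Qed.

(** Outside the prefix [lv] takes the default value [(size Q).+1], above the level of every
    block. *)
Lemma lt_lv_prefix x u :
  u \in prefix_vars Q -> lv Q x < lv Q u -> x \in prefix_vars Q.
Proof.
rewrite !inE /lv ltnS !has_find => uQ xu; exact: ltn_trans uQ.
Qed.

End Prefix.

(* A Herbrand strategy of the universal player, on total assignments: h a u
   reads a only at the levels below lv u. *)
Definition winning (V : finType) (Q : seq (block V)) (phi : cnf V)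
    (a0 : assignment V) (h : assignment V -> assignment V) : Prop :=
  (forall u (a a' : assignment V), universal Q u -> (forall x, lv Q x < lv Q u -> a x = a' x) ->
     h a u = h a' u) /\
  (forall a : assignment V, agree_off (prefix_vars Q) a0 a ->
     (forall u, universal Q u -> a u = h a u) -> ~~ sat phi a).

(** Induction on the prefix. A universal block is set to one falsifying choice; for an existential
    block every choice leaves a false formula, and the choice found in [a] selects the strategy for
    the rest. *)
Lemma false_winning (V : finType) (Q : seq (block V)) (phi : cnf V) a0 :
  pairwise (fun B B' : block V => [disjoint B.2 & B'.2]) Q ->
  qeval Q phi a0 = false -> exists h, winning Q phi a0 h.
Proof.
elim: Q a0 => [|[q X] Q IH] a0 /=.
  move=> _ nsat; exists id; split=> // a aa0 _.
  suff -> : a = a0 by rewrite nsat.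
  by apply/ffunP=> x; move/forallP/(_ x): aa0; rewrite inE /= => /eqP.
case/andP=> dX dQ.
have uX u : universal Q u -> u \notin X.
  by apply: contraL => uX; apply/negbT/(disjoint_blocks _ dX).
have lvX u x : universal Q u -> x \in X -> lv ((q, X) :: Q) x < lv ((q, X) :: Q) u.
  by move=> /uX/negbTE uX' xX; rewrite /lv /= uX' xX.
have lvQ u x : universal Q u -> lv Q x < lv Q u -> lv ((q, X) :: Q) x < lv ((q, X) :: Q) u.
  move=> /uX/negbTE uX'; rewrite /lv /= uX'; case: (x \in X) => //=.
case: q lvX lvQ => lvX lvQ /=.
- move/negbT; rewrite negb_exists => /forallP noW.
  have [h hP] : exists h : forall b : assignment V, assignment V -> assignment V,
      forall b, agree_off X a0 b -> winning Q phi b (h b).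
    apply: (@fin_all_exists _ _
      (fun b h => agree_off X a0 b -> winning Q phi b h)) => b; case ab: (agree_off X a0 b).
      have := noW b; rewrite ab /= => /negbTE/(IH _ dQ)[h hP].
      by exists h.
    (* A [b] that differs from [a0] off [X] carries no obligation, so any value serves. *)
    by exists id.
  (* Only the values on [X] may select the strategy: their level is below that of every universal
     variable of [Q]. *)
  pose mix (a : assignment V) : assignment V := [ffun x => if x \in X then a x else a0 x].
  have mixP a : agree_off X a0 (mix a).
    by apply/forallP=> x; apply/implyP=> /negbTE xX; rewrite ffunE xX.
  exists (fun a => h (mix a) a); split=> [u a a' /= un aa'|a aa0 ah].
    have -> : mix a = mix a'.
      apply/ffunP=> x; rewrite !ffunE; case: ifP => // xX.
      by apply: aa'; apply: lvX.
    by apply: (hP _ (mixP a')).1 => // x xu; apply: aa'; apply: lvQ.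
  apply: (hP _ (mixP a)).2 => [|u un]; last exact: ah.
  apply/forallP=> x; apply/implyP=> xQ; rewrite ffunE.
  case: ifP => // xX; move/forallP/(_ x): aa0; rewrite inE /= xX /=.
  by move: xQ; rewrite inE => ->.
- move/negbT; rewrite negb_forall => /existsP[b]; rewrite negb_imply.
  case/andP=> ab /negbTE/(IH _ dQ)[h [hdep hwin]].
  exists (fun a => [ffun u => if u \in X then b u else h a u]).
  split=> [u a a' /=|a aa0 ah].
    rewrite !ffunE; case: ifP => //= uX' un aa'.
    by apply: hdep => // x xu; apply: aa'; apply: lvQ.
  apply: hwin => [|u un].
    apply/forallP=> x; apply/implyP=> xQ; case xX: (x \in X).
      by rewrite (ah x) ?ffunE ?xX //= xX.
    move/forallP/(_ x): aa0; move/forallP/(_ x): ab; rewrite xX inE /= xX /=.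
    by move: xQ; rewrite inE => -> /= /eqP->.
  by rewrite (ah u) ?ffunE ?(negbTE (uX _ un)) //= un orbT.
Qed.

(** * Trails that propagate first and decide by level *)

Section Runs.

Variables (R : reduction_policy) (V : finType) (Q : seq (block V)).
Hypothesis Qdisj : pairwise (fun B B' : block V => [disjoint B.2 & B'.2]) Q.
Implicit Types (C D : clause V) (l : literal V) (S T : trail V).

Lemma reduct_sub C l : l \in reduct Q R C -> l \in C.
Proof. by case: R => //=; rewrite inE => /andP[]. Qed.

Lemma existential_reduct C l :
  l \in C -> existential Q l.1 -> l \in reduct Q R C.
Proof.
move=> lC /(existentialN_universal Qdisj)/negbTE un.
by case: R => //=; rewrite inE lC un.
Qed.

(** These are the fixed points of [red], stated through the existential literal that protects each
    universal one. *)
Definition reduced C : Prop := forall u, u \in C -> universal Q u.1 ->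
  exists x, [/\ x \in C, existential Q x.1 & lv Q u.1 <= lv Q x.1].

Lemma red_reduced C : reduced (red Q C).
Proof.
move=> u; rewrite inE => /andP[uC] + un; rewrite un /= negb_forall.
case/existsP=> x; rewrite !negb_imply -leqNgt => /andP[xC /andP[ex ux]].
exists x; split=> //.
by rewrite inE xC (negbTE (existentialN_universal Qdisj ex)).
Qed.

Definition closed_clause C : Prop := forall l, l \in C -> l.1 \in prefix_vars Q.

Lemma reduced_empty C : closed_clause C -> reduced C ->
  (forall l, l \in C -> ~~ existential Q l.1) -> C = set0.
Proof.
move=> cC rC nex; apply/setP=> l; rewrite inE; apply/negP=> lC.
have := existentialVuniversal (cC _ lC); rewrite (negbTE (nex _ lC)) /=.
by case/(rC _ lC)=> x [/nex/negbTE->].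
Qed.

Lemma closed_red C : closed_clause C -> closed_clause (red Q C).
Proof. by move=> cC l; rewrite inE => /andP[/cC]. Qed.

Lemma closed_resolve l C D :
  closed_clause C -> closed_clause D -> closed_clause (resolve l C D).
Proof. by move=> cC cD k; move=> /setUP[/setD1P[_ /cC]|/setD1P[_ /cD]]. Qed.

Lemma restrict_some C S : (forall l, l \in C -> l \notin trail_lits S) ->
  restrict C (trail_lits S) = Some [set l in C | neg l \notin trail_lits S].
Proof.
move=> nS; rewrite /restrict; case: ifP => //.
by case/existsP=> l /andP[/nS/negP].
Qed.

Lemma unit_under_unsat S C p l :
  unit_under R Q S C p -> l \in C -> l \notin trail_lits S.
Proof.
case=> D; rewrite /restrict; case: ifP => // /negbT + _ _ lC.
by rewrite negb_exists => /forallP/(_ l); rewrite lC.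
Qed.

Lemma unit_under_unassigned S C p l : unit_under R Q S C p ->
  l \in reduct Q R [set k in C | neg k \notin trail_lits S] -> p = Some l.
Proof.
case=> D; rewrite /restrict; case: ifP => // _ [->]; case: p => [k|] /=.
  by case=> _ -> /set1P->.
by move=> ->; rewrite inE.
Qed.

(** Existential literals survive reduction under either policy, so when an antecedent propagates,
    all its other existential literals are falsified. *)
Lemma unit_under_existential S C p l : unit_under R Q S C p ->
  l \in C -> existential Q l.1 -> neg l \notin trail_lits S -> p = Some l.
Proof.
move=> uC lC ex nl; apply: (unit_under_unassigned uC).
by apply: existential_reduct => //; rewrite inE lC.
Qed.

Lemma unit_under_fresh S C l : unit_under R Q S C (Some l) ->
  [/\ existential Q l.1, l \in C & l.1 \notin trail_vars S].
Proof.
move=> uC; case: (uC) => D eD [ex rD].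
have: l \in D by apply: reduct_sub; rewrite rD set11.
move: eD; rewrite /restrict; case: ifP => // _ [<-].
rewrite inE => /andP[lC nl]; split=> //.
by rewrite mem_trail_vars negb_or (unit_under_unsat uC lC).
Qed.

(** Decidable form, for the case distinctions that build a trail. *)
Definition unit_underb S C (p : option (literal V)) : bool :=
  if restrict C (trail_lits S) is Some D then
    if p is Some l then existential Q l.1 && (reduct Q R D == [set l])
    else reduct Q R D == set0
  else false.

Lemma unit_underP S C p : reflect (unit_under R Q S C p) (unit_underb S C p).
Proof.
rewrite /unit_underb /unit_under; case: restrict => [D|]; last first.
  by apply: ReflectF; case.
apply: (iffP idP) => [uD|[_ [<-]]].
  by exists D => //; case: p uD => [l /andP[ex /eqP]|/eqP].
by case: p => [l [ex ->]|->]; rewrite /= ?ex eqxx.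
Qed.

Variable phi : cnf V.

(* The decisions follow the levels over all variables of the prefix, also those
   that do not occur in phi: this satisfies all four policies at once. *)
Definition step S (e : trail_elem V) : Prop :=
  ~~ has (@is_conflict V) S /\
  match e with
  | Decide d =>
      [/\ d.1 \in prefix_vars Q, d.1 \notin trail_vars S,
          forall x, x \in prefix_vars Q -> x \notin trail_vars S ->
            lv Q d.1 <= lv Q x
        & forall C p, C \in phi -> ~ unit_under R Q S C p]
  | Propagate p A =>
      [/\ A \in phi, unit_under R Q S A p
        & (exists2 C, C \in phi & unit_under R Q S C None) -> p = None]
  end.

(** Naturality is built in through [step]; the values of universal decisions are left free here and
    constrained by [plays]. *)
Definition run T : Prop := forall S e S', T = S ++ e :: S' -> step S e.

Lemma run_rconsP S e : run (rcons S e) <-> run S /\ step S e.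
Proof.
split=> [rS|[rS se] S1 e1 S2].
  split=> [S1 e1 S2 eS|]; last by apply: (rS S e [::]); rewrite cats1.
  by apply: (rS S1 e1 (rcons S2 e)); rewrite eS rcons_cat.
case/lastP: S2 => [|S2 e2]; rewrite ?cats1 -?rcons_cons -?rcons_cat => /rcons_inj[].
  by move=> <- <-.
by move=> eS _; apply: rS eS.
Qed.

Lemma run_cat S S' : run (S ++ S') -> run S.
Proof.
move=> rS S1 e S2 eS; apply: (rS S1 e (S2 ++ S')).
by rewrite eS -catA.
Qed.

Lemma run_uniq T : run T -> uniq (trail_vars T).
Proof.
elim/last_ind: T => [|S e IH] // /run_rconsP[/IH uS [_ se]].
rewrite -cats1 trail_vars_cat cat_uniq uS; case: e se => [d [_ dS _ _]|[l|] A] /=.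
- by rewrite orbF dS.
- by case=> _ /unit_under_fresh[_ _ lS] _; rewrite orbF lS.
- by [].
Qed.

Lemma run_vars T : run T -> {subset trail_vars T <= prefix_vars Q}.
Proof.
elim/last_ind: T => [|S e IH] // /run_rconsP[/IH vS [_ se]] x.
rewrite -cats1 trail_vars_cat mem_cat => /orP[/vS//|].
case: e se => [d [dQ _ _ _]|[l|] A] //=; rewrite inE.
- by move/eqP->.
- by case=> _ /unit_under_fresh[ex _ _] _ /eqP->; apply: existential_prefix.
Qed.

Lemma run_universal T l :
  run T -> l \in trail_lits T -> universal Q l.1 -> l \in decisions T.
Proof.
elim/last_ind: T => [|S e IH] // /run_rconsP[rS [_ se]] lS un; move: lS.
rewrite -cats1 trail_lits_cat decisions_cat !mem_cat => /orP[/(IH rS)->//|].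
case: e se => [d _|[k|] A] //=; first by move->; rewrite orbT.
case=> _ /unit_under_fresh[ex _ _] _; rewrite inE => /eqP lk.
by rewrite lk (negbTE (existentialN_universal Qdisj ex)) in un.
Qed.

(** [d] was still unassigned when [d'] was decided, and [d'] had least level at that point. *)
Lemma run_decision_lv S d d' : run (rcons S (Decide d)) -> d' \in decisions S ->
  lv Q d'.1 <= lv Q d.1.
Proof.
move=> /run_rconsP[rS [_ [dQ dS _ _]]] /decision_split[S1 [S2 eS]].
have [_ [_ _ min _]] := rS _ _ _ eS; apply: min => //.
by apply: contra dS; rewrite eS trail_vars_cat mem_cat => ->.
Qed.

Lemma run_decisions_sorted T : run T -> sorted leq [seq lv Q l.1 | l <- decisions T].
Proof.
move=> rT; apply: pairwise_sorted; elim/last_ind: T rT => [|S e IH] // rT.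
have [/IH pS _] := (run_rconsP S e).1 rT.
rewrite -cats1 decisions_cat map_cat; case: e rT => [d|p A] rT /=; last by rewrite cats0.
rewrite cats1 pairwise_rcons pS andbT; apply/allP=> _ /mapP[d' d'S ->].
exact: run_decision_lv rT d'S.
Qed.

Hypothesis phiQ : cvars phi \subset prefix_vars Q.

Lemma closed_member C : C \in phi -> closed_clause C.
Proof.
move=> Cphi l lC; apply: (subsetP phiQ); rewrite inE.
by apply/existsP; exists C; rewrite Cphi; apply/existsP; exists l; rewrite lC /=.
Qed.

(** LEV-ORD is minimality, and ASS-ORD follows as decision levels never decrease. For ASS-R-ORD,
    minimality puts every lower universal variable on the trail, and universal variables get there
    only by decisions. *)
Lemma run_decision_allowed P S d : run (rcons S (Decide d)) ->
  decision_allowed P Q phi S d.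
Proof.
move=> rT; have [rS [_ [dQ dS min _]]] := (run_rconsP S _).1 rT.
case: P => //=.
- by move=> x xphi; apply: min; apply: (subsetP phiQ).
- move=> _; have := run_decisions_sorted rT.
  by rewrite -cats1 decisions_cat /= cats1.
- move=> _ u un ud; have uS : u \in trail_vars S.
    apply: contraLR ud => uS; rewrite -leqNgt min //.
    exact: universal_prefix.
  case/mapP: uS => l lS ul; rewrite ul in un *.
  by apply/mapP; exists l => //; apply: run_universal.
Qed.

Lemma run_is_trail P T : run T -> is_trail P R Q phi T.
Proof.
move=> rT; split=> [|k e ke]; first exact: run_uniq.
have eT := onth_take_drop ke; have [nc se] := rT _ _ _ eT.
have rk : run (rcons (take k T) e).
  by apply: (@run_cat _ (drop k.+1 T)); rewrite cat_rcons -eT.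
case: e ke eT se rk => [d|p A] ke eT.
  by case=> dQ _ _ _ rk; split=> //; apply: run_decision_allowed.
case=> Aphi uA _ rk; split=> // p0.
have kT : k < size T by rewrite -onthTE ke.
apply/eqP; rewrite eqn_leq kT andbT leqNgt; apply/negP=> kT'.
case dT: (drop k.+1 T) eT => [|e' S'] eT.
  by move: kT'; rewrite -subn_gt0 -size_drop dT.
(* Each element of a run requires a conflict-free past, so nothing follows a conflict. *)
have := rT (rcons (take k T) (Propagate p A)) e' S'.
rewrite cat_rcons -eT => /(_ erefl)[]; rewrite has_rcons p0 //.
Qed.

Lemma run_natural T : run T -> in_conflict T -> natural_from R Q phi T 0.
Proof.
move=> rT [A [T' eT]] j jT; rewrite /natural_at /= => nc [C [p [Cphi uC]]].
case je: (onth T j) => [e|]; last first.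
  (* Past the last element the segment is all of [T] and already holds the conflict. *)
  have jT' : size T <= j by rewrite -onthNE je.
  by move: nc; rewrite take_oversize // eT has_rcons.
have [_ se] := rT _ _ _ (onth_take_drop je).
case: e se je => [d [_ _ _ nu]|q B [Bphi uB qN]] je; first by case: (nu _ _ Cphi uC).
by exists B, q.
Qed.

(** * Runs against a winning strategy *)

Variables (psi : cnf V) (h : assignment V -> assignment V).
Hypothesis psi_phi : psi \subset phi.
Hypothesis h_winning : winning Q psi [ffun=> false] h.

(** Unassigned variables read as false, so that off the prefix this agrees with the start assignment
    in [h_winning]. *)
Definition trail_assignment S : assignment V :=
  [ffun x => (x, true) \in trail_lits S].

Lemma trail_assignmentP S l :
  uniq (trail_vars S) -> l \in trail_lits S -> trail_assignment S l.1 = l.2.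
Proof.
move=> uS lS; rewrite ffunE; case: l lS => x [] //= lS.
by have /negbTE := trail_consistent uS lS.
Qed.

(** The second conjunct keeps the first one stable: [h] reads only lower levels, whose values no
    longer change when the trail grows. *)
Definition plays S : Prop := forall l, l \in trail_lits S -> universal Q l.1 ->
  l.2 = h (trail_assignment S) l.1 /\
  forall x, lv Q x < lv Q l.1 -> x \in trail_vars S.

Lemma plays_rcons S e : run (rcons S e) -> plays S ->
  (forall d, e = Decide d -> d.2 = h (trail_assignment S) d.1) ->
  plays (rcons S e).
Proof.
move=> rT pS eh.
have [rS [_ se]] := (run_rconsP S e).1 rT.
have uT := run_uniq rT; have uS := run_uniq rS.
have vST x : x \in trail_vars S -> x \in trail_vars (rcons S e).
  by rewrite -cats1 trail_vars_cat mem_cat => ->.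
have agree x : x \in trail_vars S ->
    trail_assignment S x = trail_assignment (rcons S e) x.
  case/mapP=> l lS ->; rewrite !trail_assignmentP //.
  by rewrite -cats1 trail_lits_cat mem_cat lS.
have lift u b : universal Q u -> b = h (trail_assignment S) u ->
    (forall x, lv Q x < lv Q u -> x \in trail_vars S) ->
    b = h (trail_assignment (rcons S e)) u /\
    forall x, lv Q x < lv Q u -> x \in trail_vars (rcons S e).
  move=> un -> low; split=> [|x /low/vST//].
  by apply: h_winning.1 => // x /low/agree.
move=> l; rewrite {1}/trail_lits -cats1 pmap_cat mem_cat => /orP[lS|le] un.
  by have [lh low] := pS _ lS un; rewrite cats1; apply: lift.
rewrite cats1; case: e se eh le rT {vST agree uT} lift => [d|[k|] A] se eh //=;
  rewrite inE => /eqP lk rT lift.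
  rewrite lk in un *; apply: lift => //; first exact: eh.
  case: se => _ _ min _ x xd; apply: contraLR xd => xS; rewrite -leqNgt.
  case xQ: (x \in prefix_vars Q); first exact: min.
  rewrite leqNgt; apply/negP=> /(lt_lv_prefix (universal_prefix un)).
  by rewrite xQ.
case: se => _ /unit_under_fresh[ex _ _] _.
by rewrite lk (negbTE (existentialN_universal Qdisj ex)) in un.
Qed.

(** The total assignment follows the strategy, so some clause of [psi] has all its literals
    falsified and restricts to the empty clause. *)
Lemma total_run_conflict S : run S -> plays S ->
  {subset prefix_vars Q <= trail_vars S} ->
  exists2 C, C \in phi & unit_under R Q S C None.
Proof.
move=> rS pS total; have uS := run_uniq rS.
have : ~~ sat psi (trail_assignment S); first apply: h_winning.2.
- apply/forallP=> x; apply/implyP=> xQ; rewrite !ffunE eqbF_neg.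
  apply: contra xQ => xS; apply: (run_vars rS).
  by apply/mapP; exists (x, true).
- move=> u un; have /total/mapP[l lS ul] := universal_prefix un.
  by rewrite ul in un *; rewrite trail_assignmentP //; have [] := pS _ lS un.
rewrite negb_forall => /existsP[C]; rewrite negb_imply => /andP[Cpsi].
rewrite negb_exists => /forallP nC; have Cphi := subsetP psi_phi _ Cpsi.
have unsat l : l \in C -> l \notin trail_lits S.
  move=> lC; apply/negP=> lS.
  by have := nC l; rewrite lC trail_assignmentP ?eqxx.
exists C => //; exists [set l in C | neg l \notin trail_lits S].
  exact: restrict_some.
rewrite /unit_literal; suff -> : [set l in C | neg l \notin trail_lits S] = set0.
  by apply/setP=> l; rewrite inE; apply/negP=> /reduct_sub; rewrite inE.
apply/setP=> l; rewrite !inE; case lC: (l \in C) => //=.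
have := total _ (closed_member Cphi lC).
by rewrite mem_trail_vars (negbTE (unsat _ lC)) /= => ->.
Qed.

(** Induction on the number of unassigned prefix variables. A conflict is tried first, then a
    propagation, then a decision. *)
Lemma conflict_run_from S : run S -> plays S -> ~~ has (@is_conflict V) S ->
  exists T, run T /\ in_conflict T.
Proof.
move: {2}_.+1 (ltnSn #|[set x in prefix_vars Q | x \notin trail_vars S]|) => n.
elim: n S => // n IH S; rewrite ltnS => le_n rS pS nc.
have extend e l : elem_lit e = Some l -> l.1 \in prefix_vars Q ->
    step S e -> l.1 \notin trail_vars S ->
    (forall d, e = Decide d -> d.2 = h (trail_assignment S) d.1) ->
    exists T, run T /\ in_conflict T.
  move=> el lQ se lS eh; have rT : run (rcons S e) by apply/run_rconsP.
  apply: (IH (rcons S e)) => //; last first.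
  - by rewrite has_rcons negb_or nc andbT; case: (e) el => [d|[]].
  - exact: plays_rcons.
  apply: leq_trans le_n; apply: proper_card; apply/properP; split.
    apply/subsetP=> x; rewrite !inE => /andP[-> /=].
    by apply: contra; rewrite -cats1 trail_vars_cat mem_cat => ->.
  exists l.1; first by rewrite inE lQ.
  rewrite inE lQ /= negbK -cats1 trail_vars_cat mem_cat.
  by rewrite /trail_vars /trail_lits /= el /= inE eqxx orbT.
case: (boolP [exists C in phi, unit_underb S C None]) => [/existsP[C]|noc].
  case/andP=> Cphi /unit_underP uC; exists (rcons S (Propagate None C)).
  by split; [apply/run_rconsP | exists C, S].
have {}noc C : C \in phi -> ~ unit_under R Q S C None.
  move=> Cphi uC; case/negP: noc; apply/existsP; exists C.
  by rewrite Cphi; apply/unit_underP.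
case: (boolP [exists C in phi, [exists l, unit_underb S C (Some l)]]) => [/existsP[C]|nou].
  case/andP=> Cphi /existsP[l /unit_underP uC].
  have [ex lC lS] := unit_under_fresh uC.
  apply: (extend (Propagate (Some l) C) l) => //.
    exact: existential_prefix.
  by split=> //; split=> // [[C' /noc uC' /uC']].
have {}nou C p : C \in phi -> ~ unit_under R Q S C p.
  case: p => [l|]; last exact: noc.
  move=> Cphi uC; case/negP: nou; apply/existsP; exists C.
  by rewrite Cphi; apply/existsP; exists l; apply/unit_underP.
case: (boolP (prefix_vars Q \subset trail_vars S)) => [/subsetP total|].
  by have [C Cphi /(noc _ Cphi)] := total_run_conflict rS pS total.
case/subsetPn=> x0 x0Q x0S.
have [x /andP[xQ xS] min] := @arg_minnP _ x0
  [pred x | (x \in prefix_vars Q) && (x \notin trail_vars S)] (lv Q) (introT andP (conj x0Q x0S)).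
(* The value of [h] is taken for existential variables too, where either value would do. *)
apply: (extend (Decide (x, h (trail_assignment S) x)) (x, h (trail_assignment S) x)) => //.
  split=> //; split=> // y yQ yS; apply: min; exact/andP.
by move=> _ [<-].
Qed.

Lemma conflict_run : exists T, run T /\ in_conflict T.
Proof.
by apply: (@conflict_run_from [::]) => //; move=> [|? ?].
Qed.

End Runs.

(** * Clauses learned from a conflict *)

Section Learning.

Variables (V : finType) (Q : seq (block V)).
Hypothesis Qdisj : pairwise (fun B B' : block V => [disjoint B.2 & B'.2]) Q.
Variable phi : cnf V.
Hypothesis phiQ : cvars phi \subset prefix_vars Q.
Implicit Types (C : clause V) (l : literal V) (S T : trail V).

(** Either outcome is progress: the refutation is complete or the clause set grows. *)
Definition new_clause C : Prop := closed_clause Q C /\ (C = set0 \/ C \notin phi).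

Lemma mem_red C l : l \in red Q C -> l \in C.
Proof. by rewrite inE => /andP[]. Qed.

Lemma mem_resolve C A p l :
  l \in red Q (resolve (neg p) C (red Q A)) ->
  l \in C /\ l != neg p \/ l \in A /\ l != p.
Proof.
move/mem_red=> /setUP[/setD1P[lp lC]|/setD1P[lp /mem_red lA]]; [left | right] => //.
by rewrite negK in lp.
Qed.

(** The natural condition in use: no member of [phi] is unit at a decision, so a clause that reduces
    to [neg d] there is not in [phi]. *)
Lemma decision_blocks_unit R S d C : run R Q phi (rcons S (Decide d)) ->
  existential Q d.1 -> neg d \in C -> C \in phi ->
  (forall l, l \in C -> l \notin trail_lits S) ->
  reduct Q R [set l in C | neg l \notin trail_lits S] != [set neg d].
Proof.
move=> /run_rconsP[_ [_ [_ _ _ nou]]] ex dC Cphi unsat; apply/eqP=> rD.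
apply: (nou C (Some (neg d)) Cphi).
by exists [set l in C | neg l \notin trail_lits S]; first exact: restrict_some.
Qed.

Lemma decision_neg_unassigned R S d C : run R Q phi (rcons S (Decide d)) ->
  neg d \in C -> neg d \in [set l in C | neg l \notin trail_lits S].
Proof.
move=> /run_rconsP[_ [_ [_ dS _ _]]] dC; rewrite inE dC negK.
by apply: contra dS => dS; rewrite mem_trail_vars dS.
Qed.

(** [S] is the part still to be scanned. The invariant lets universal literals stay unassigned; the
    scan stops at the first existential decision that falsifies a literal of the clause. *)
Lemma learn_red S pi : run Red Q phi S -> ~~ has (@is_conflict V) S ->
  closed_clause Q (conclusion Q pi) -> reduced Q (conclusion Q pi) ->
  (forall l, l \in conclusion Q pi -> existential Q l.1 ->
     neg l \in trail_lits S) ->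
  (forall l, l \in conclusion Q pi -> l \notin trail_lits S) ->
  exists j pi', onth (pi :: learn Q pi (rev S)) j = Some pi' /\
    new_clause (conclusion Q pi').
Proof.
elim/last_ind: S pi => [|S e IH] pi rT nc cC rC falsified unsat.
  exists 0, pi; split=> //; split=> //; left; apply: (reduced_empty cC rC) => l lC.
  by apply/negP=> /(falsified _ lC).
rewrite rev_rcons; have [rS [ncS se]] := (run_rconsP _ _ _ S e).1 rT.
have litsE : trail_lits (rcons S e) = trail_lits S ++ trail_lits [:: e].
  by rewrite -cats1 trail_lits_cat.
have unsatS l : l \in conclusion Q pi -> l \notin trail_lits S.
  by move/unsat; rewrite litsE mem_cat negb_or => /andP[].
case: e rT nc se litsE {unsat} falsified => [d|[p|] A] rT nc se /= -> falsified; last first.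
- by rewrite has_rcons in nc.
- have [Aphi uA _] := se.
  set pi' := if _ then _ else _.
  suff [j [pi'' [jpi newC]]] : exists j pi'',
      onth (pi' :: learn Q pi' (rev S)) j = Some pi'' /\ new_clause (conclusion Q pi'').
    by exists j.+1, pi''.
  rewrite /pi'; case: ifP => pC.
    apply: IH => //=.
    + do ?[apply: closed_red | apply: closed_resolve] => //.
      exact: closed_member phiQ _ Aphi.
    + exact: red_reduced.
    + move=> l /mem_resolve[[lC lp]|[lA lp]] ex.
        have := falsified _ lC ex; rewrite mem_cat inE => /orP[//|/eqP nl].
        by rewrite -nl negK eqxx in lp.
      apply: contraT => nl; have [pl] := unit_under_existential Qdisj uA lA ex nl.
      by rewrite pl eqxx in lp.
    + by move=> l /mem_resolve[[/unsatS]|[/(unit_under_unsat uA)]].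
  apply: IH => // l lC ex; have := falsified _ lC ex.
  by rewrite mem_cat inE => /orP[//|/eqP nl]; rewrite -nl negK lC in pC.
- case: (boolP ((neg d \in conclusion Q pi) && existential Q d.1)) => [/andP[dC ex]|dC].
    exists 0, pi; split=> //; split=> //; right; apply/negP=> Cphi.
    have /eqP[] := decision_blocks_unit rT ex dC Cphi unsatS.
    have dD := decision_neg_unassigned rT dC.
    have exD l : l \in [set k in conclusion Q pi | neg k \notin trail_lits S] ->
        existential Q l.1 -> l = neg d.
      rewrite inE => /andP[lC nl] /(falsified _ lC).
      by rewrite mem_cat (negbTE nl) inE => /eqP<-; rewrite negK.
    apply/setP=> l; rewrite in_set1; apply/idP/eqP=> [lD|->]; last first.
      by apply: (existential_reduct Red).
    have /setIdP[lC nl] := mem_red lD.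
    have /orP[|un] := existentialVuniversal (cC _ lC).
      exact: exD (mem_red lD).
    (* A universal literal left over could be protected by [neg d] only, so its level is at most
       that of [d]; being unassigned it has at least that level, and levels of opposite quantifiers
       differ. *)
    have [x [xD exx lx]] := red_reduced Qdisj lD un.
    rewrite (exD _ (mem_red xD) exx) in lx.
    have [_ _ min _] := se.
    have /eqP[] := lv_existential_universal Qdisj ex un.
    apply/eqP; rewrite eqn_leq lx andbT min ?cC //.
    by rewrite mem_trail_vars negb_or unsatS.
  have [j [pi' jP]] : exists j pi',
      onth (pi :: learn Q pi (rev S)) j = Some pi' /\ new_clause (conclusion Q pi').
    apply: IH => // l lC ex; have := falsified _ lC ex.
    rewrite mem_cat inE => /orP[//|/eqP nl].
    by case/negP: dC; rewrite -nl negK lC ex.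
  by exists j, pi'.
Qed.

(** The scan runs to the left end, so [T] stays fixed while [S] shrinks. An existential literal is
    falsified within [S] or by a decision anywhere in [T]. *)
Lemma learn_nored T S S' pi : run NoRed Q phi T -> T = S ++ S' ->
  ~~ has (@is_conflict V) S ->
  closed_clause Q (conclusion Q pi) -> reduced Q (conclusion Q pi) ->
  (forall l, l \in conclusion Q pi -> existential Q l.1 ->
     (neg l \in trail_lits S) || (neg l \in decisions T)) ->
  (forall l, l \in conclusion Q pi -> universal Q l.1 ->
     neg l \in trail_lits T) ->
  exists j pi', onth (pi :: learn Q pi (rev S)) j = Some pi' /\
    new_clause (conclusion Q pi').
Proof.
move=> rT; elim/last_ind: S S' pi => [|S e IH] S' pi eT nc cC rC exC unC.
  exists 0, pi; split=> //; split=> //.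
  (* With [S] empty this is the leftmost clause, and its existential literals are all negated
     decisions. *)
  pose p l := (neg l \in conclusion Q pi) && existential Q l.1.
  case: (boolP (has p (decisions T))) => [/last_decision_split|nd]; last first.
    left; apply: (reduced_empty cC rC) => l lC; apply/negP=> ex.
    have /= nlT := exC _ lC ex; case/hasP: nd; exists (neg l) => //.
    by rewrite /p negK lC ex.
  case=> S [d [S2 [eTd /andP[dC ex] nS2]]].
  right; apply/negP=> Cphi.
  have rd : run NoRed Q phi (rcons S (Decide d)).
    by apply: (@run_cat _ _ _ _ _ S2); rewrite cat_rcons -eTd.
  have [_ [_ [_ dS min _]]] := (run_rconsP _ _ _ S _).1 rd.
  have uT := run_uniq rT.
  have subT : {subset trail_lits S <= trail_lits T}.
    by move=> l lS; rewrite eTd trail_lits_cat mem_cat lS.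
  have exS l : l \in conclusion Q pi -> existential Q l.1 ->
      l = neg d \/ neg l \in decisions S.
    move=> lC exl; have /= := exC _ lC exl; rewrite eTd decisions_cat mem_cat inE.
    case/or3P=> [->|/eqP<-|nl]; [by right | by left; rewrite negK |].
    by case/hasP: nS2; exists (neg l) => //; rewrite /p negK lC exl.
  (* The protecting literal negates [d] or an earlier decision, so the universal literal lies
     strictly below [d] and was assigned before it; [T] fixes the polarity. *)
  have unS l : l \in conclusion Q pi -> universal Q l.1 -> neg l \in trail_lits S.
    move=> lC un; have [x [xC exx lx]] := rC _ lC un.
    have xd : lv Q x.1 <= lv Q d.1.
      case: (exS _ xC exx) => [->//|nx]; exact: (run_decision_lv rd nx).
    have lS : l.1 \in trail_vars S.
      apply: contraT => lS; have /eqP[] := lv_existential_universal Qdisj ex un.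
      apply/eqP; rewrite eqn_leq (leq_trans lx xd) andbT min //.
      exact: universal_prefix.
    move: lS; rewrite mem_trail_vars => /orP[/subT lT|//].
    by have := trail_consistent uT lT; rewrite (unC _ lC un).
  have falsified l : l \in conclusion Q pi -> l = neg d \/ neg l \in trail_lits S.
    move=> lC; have /orP[exl|un] := existentialVuniversal (cC _ lC).
      by case: (exS _ lC exl) => [|/decisions_sub]; [left | right].
    by right; apply: unS.
  have unsat l : l \in conclusion Q pi -> l \notin trail_lits S.
    case/falsified=> [->|nl].
      by apply: contra dS => nd; rewrite mem_trail_vars nd orbT.
    by rewrite -[l]negK; apply: trail_consistent nl; apply: run_uniq ((run_rconsP _ _ _ _ _).1 rd).1.
  have /eqP[] := decision_blocks_unit rd ex dC Cphi unsat.
  apply/setP=> l; rewrite in_set1 /=; apply/idP/eqP=> [|->]; last first.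
    exact: decision_neg_unassigned rd dC.
  by rewrite inE => /andP[/falsified[//|->]].
rewrite rev_rcons; have eT' : T = S ++ e :: S' by rewrite -cat_rcons.
have [ncS se] := rT _ _ _ eT'.
have litsE : trail_lits (rcons S e) = trail_lits S ++ trail_lits [:: e].
  by rewrite -cats1 trail_lits_cat.
have subT : {subset trail_lits S <= trail_lits T}.
  by move=> l lS; rewrite eT' trail_lits_cat mem_cat lS.
case: e nc se litsE eT eT' exC => [d|[p|] A] nc se /= -> eT eT' exC; last first.
- by rewrite has_rcons in nc.
- have [Aphi uA _] := se.
  have [exp _ _] := unit_under_fresh uA.
  set pi' := if _ then _ else _.
  suff [j [pi'' [jpi newC]]] : exists j pi'',
      onth (pi' :: learn Q pi' (rev S)) j = Some pi'' /\ new_clause (conclusion Q pi'').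
    by exists j.+1, pi''.
  rewrite /pi'; case: ifP => pC.
    apply: (IH _ _ eT') => //=.
    + do ?[apply: closed_red | apply: closed_resolve] => //.
      exact: closed_member phiQ _ Aphi.
    + exact: red_reduced.
    + move=> l /mem_resolve[[lC lp]|[lA lp]] ex.
        have := exC _ lC ex; rewrite mem_cat inE -orbA => /or3P[->//|/eqP nl|->].
          by rewrite -nl negK eqxx in lp.
        by rewrite orbT.
      apply/orP; left; apply: contraT => nl.
      have [pl] := unit_under_existential Qdisj uA lA ex nl.
      by rewrite pl eqxx in lp.
    + move=> l /mem_resolve[[lC _]|[lA lp]] un; first exact: unC.
      apply: subT; apply: contraT => nl.
      (* Without reduction an antecedent has no unassigned literal besides the propagated one. *)
      have lD : l \in reduct Q NoRed [set k in A | neg k \notin trail_lits S].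
        by rewrite inE lA.
      have [pl] := unit_under_unassigned uA lD.
      by rewrite pl eqxx in lp.
  apply: (IH _ _ eT') => // l lC ex; have := exC _ lC ex.
  rewrite mem_cat inE -orbA => /or3P[->//|/eqP nl|->]; last by rewrite orbT.
  by rewrite -nl negK lC in pC.
(* The decision leaves [S], so a literal that it falsifies moves to the second alternative of the
   invariant. *)
- apply: (IH _ _ eT') => // l lC ex; have := exC _ lC ex.
  rewrite mem_cat inE -orbA => /or3P[->//|/eqP->|->]; last by rewrite orbT.
  by rewrite eT' decisions_cat mem_cat inE eqxx !orbT.
Qed.

Lemma learn_new R T : run R Q phi T -> in_conflict T ->
  exists j pi, onth (learnable Q T) j = Some (conclusion Q pi, pi) /\
    new_clause (conclusion Q pi).
Proof.
move=> rT [A [S eT]].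
have [rS [nc [Aphi uA _]]] : run R Q phi S /\ step R Q phi S (Propagate None A).
  by apply/run_rconsP; rewrite -eT.
have cA : closed_clause Q (red Q A) by apply/closed_red/(closed_member phiQ).
have falsified l : l \in red Q A -> existential Q l.1 -> neg l \in trail_lits S.
  move=> /mem_red lA ex; apply: contraT => nl.
  by have := unit_under_existential Qdisj uA lA ex nl.
suff [j [pi [jpi newC]]] : exists j pi,
    onth (Red_step (Ax_step A) :: learn Q (Red_step (Ax_step A)) (rev S)) j = Some pi /\
    new_clause (conclusion Q pi).
  by exists j, pi; split=> //; rewrite /learnable eT rev_rcons onth_map jpi.
case: R rT rS uA => rT rS uA.
  apply: learn_red => //=; first exact: red_reduced.
  by move=> l /mem_red; apply: unit_under_unsat uA.
have eT1 : T = S ++ [:: Propagate None A] by rewrite cats1.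
apply: (learn_nored rT eT1) => //=; first exact: red_reduced.
  by move=> l lA ex; rewrite falsified.
move=> l /mem_red lA _; rewrite eT1 trail_lits_cat mem_cat; apply/orP; left.
apply: contraT => nl; suff: None = Some l by [].
by apply: (unit_under_unassigned uA); rewrite inE lA.
Qed.

End Learning.

(** * Restarting until the empty clause is learned *)

Section Refutation.

Variables (P : decision_policy) (R : reduction_policy).
Variables (V : finType) (Q : seq (block V)) (psi : cnf V).
Hypothesis Qdisj : pairwise (fun B B' : block V => [disjoint B.2 & B'.2]) Q.
Hypothesis psi_false : qeval Q psi [ffun=> false] = false.

(** Every round restarts, hence naturality from position 0 throughout. *)
Definition round (phi : cnf V) (T : trail V) C (pi : derivation V) : Prop :=
  [/\ is_trail P R Q phi T, in_conflict T,
      exists j, onth (learnable Q T) j = Some (C, pi)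
    & natural_from R Q phi T 0].

(** Induction on the number of clauses outside [phi], which drops with each new learned clause. The
    original matrix [psi] stays fixed, as the strategy has to beat only that. *)
Lemma refutation_from (phi : cnf V) :
  psi \subset phi -> cvars phi \subset prefix_vars Q ->
  exists Ts Cs pis,
    [/\ size Ts = size Cs, size pis = size Cs,
        onth Cs (size Cs).-1 = Some set0
      & forall i T C pi, onth Ts i = Some T -> onth Cs i = Some C ->
          onth pis i = Some pi -> round (phi :|: [set D in take i Cs]) T C pi].
Proof.
have [n] := ubnP #|~: phi|; elim: n phi => // n IH phi; rewrite ltnS => le_n psi_phi phiQ.
have [h hP] := false_winning Qdisj psi_false.
have [T [rT cT]] := conflict_run R Qdisj phiQ psi_phi hP.
have [j [pi [jpi [cC C0]]]] := learn_new Qdisj phiQ rT cT.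
set C := conclusion Q pi in jpi cC C0.
have rd : round phi T C pi.
  split=> //; [exact: run_is_trail | by exists j | exact: run_natural].
have phi0 : phi :|: [set D in [::]] = phi.
  by apply/setP=> D; rewrite !inE orbF.
case: C0 => [C0|Cphi].
  exists [:: T], [:: C], [:: pi]; split=> //=; first by rewrite C0.
  move=> [|i] T' C' pi' /=; last by rewrite onth0n.
  by move=> [<-] [<-] [<-]; rewrite phi0.
have phi'Q : cvars (C |: phi) \subset prefix_vars Q.
  apply/subsetP=> x; rewrite inE => /existsP[D /andP[/setU1P[->|Dphi]]].
    by case/existsP=> l /andP[lC /eqP<-]; apply: cC.
  by case/existsP=> l /andP[lD /eqP<-]; apply: (closed_member phiQ Dphi).
have [||//|Ts [Cs [pis [sT sp last_C rounds]]]] := IH (C |: phi).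
- apply: leq_trans le_n; apply: proper_card; rewrite properC; apply: properUr.
  by rewrite sub1set.
- by apply: subset_trans psi_phi (subsetUr _ _).
exists (T :: Ts), (C :: Cs), (pi :: pis); split=> /=; rewrite ?sT ?sp //.
  by case: (Cs) last_C.
case=> [|i] T' C' pi' /=; first by move=> [<-] [<-] [<-]; rewrite phi0.
move=> iT iC ipi; have := rounds _ _ _ _ iT iC ipi.
suff -> : C |: phi :|: [set D in take i Cs] = phi :|: [set D in C :: take i Cs] by [].
by apply/setP=> D; rewrite !inE -orbA orbCA.
Qed.

End Refutation.

Theorem theorem3p16 (P : decision_policy) (R : reduction_policy)
    (V : finType) (Phi : qcnf V) :
  qcnf_false Phi -> exists pf : qcdcl_object V, qcdcl_refutation P R Phi pf.
Proof.
move=> false_Phi.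
have [Ts [Cs [pis [sT sp last_C rounds]]]] := refutation_from P R
  (blocks_disjoint Phi) false_Phi (subxx _) (qcnf_closed Phi).
exists (QCDCL Ts Cs pis); split=> //= i T C pi iT iC ipi.
have [tT cT lC nT] := rounds _ _ _ _ iT iC ipi; split=> //.
case: i iT iC ipi nT {tT lC rounds} => [|i] iT iC ipi nT //.
case iT': (onth Ts i) => [T'|]; last first.
  have : size Ts <= i by rewrite -onthNE iT'.
  by move/leqW/onth_default; rewrite iT.
(* Backtracking to position 0 is a full restart. *)
by exists T', 0; rewrite !take0.
Qed.
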